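(* Let $(c_h^n)_{0\le n\le N_T}$ be the sequence of discrete order parameters produced by the fully discrete discontinuous Galerkin scheme (with flux limiter $\mathcal{L}$ and slope limiter $\mathcal{S}$) described in the context, where the initial datum satisfies $-1\le c^0\le 1$ in $\Omega$. Then $$-1 \leq c_h^n(\boldsymbol{x}) \leq +1, \qquad \boldsymbol{x}\in\Omega,\quad 0\leq n\leq N_T.$$
   Context: **Data.** $\Omega\subset\mathbb{R}^3$ is an open bounded polygonal domain partitioned into a finite mesh $\mathcal{T}_h=\{E_k\}$ of cubes of the same size; $h$ is the maximum element diameter, $|E|$ the volume of $E$, $\Gamma_h$ the set of interior faces. The boundary is a disjoint union $\partial\Omega=\partial\Omega^{\mathrm{wall}}\cup\partial\Omega^{\mathrm{in}}\cup\partial\Omega^{\mathrm{out}}$ of (possibly empty) sets of faces. Given: $T>0$, time step $\tau=T/N_T$; positive constants $\mathrm{Pe},\mathrm{Cn},\mathrm{Re},\mathrm{Ca},\rho_A,\rho_B$; $\rho_{\mathrm{ref}}>0$; initial data $c^0$, $\boldsymbol{v}^0$; inflow data $c_D$, $\boldsymbol{v}_D$ (time independent); contact angle $\theta$ and a scalar field $\delta$. $\Phi_+(c)=\frac14(1+c^4)$, $\Phi_-(c)=-\frac12c^2$. $\rho(c)=\frac{1+c}{2}\rho_A+\frac{1-c}{2}\rho_B$. Set $c_\ast=-1$, $c^\ast=+1$. **Discrete spaces and notation.** For an integer $r\ge1$, $X_h=\{\chi\in L^2(\Omega):\chi|_{E}\in\mathbb{Q}_r(E)\ \forall E\in\mathcal{T}_h\}$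 and $\boldsymbol{X}_h=(X_h)^3$. Values of discrete functions on faces of $E$ are traces from $E$. For an interior face $e=\partial E_{k^-}\cap\partial E_{k^+}$, $k^-<k^+$, $\boldsymbol{n}_e$ is the unit normal pointing from $E_{k^-}$ to $E_{k^+}$; on boundary faces it is the unit outward normal $\boldsymbol{n}$ to $\partial\Omega$. $\{\chi\}=\frac12(\chi|_{E_{k^-}}+\chi|_{E_{k^+}})$ and $[\chi]=\chi|_{E_{k^-}}-\chi|_{E_{k^+}}$ on interior faces (componentwise for vectors), and both equal the trace on boundary faces. $(\cdot,\cdot)$ is the $L^2(\Omega)$ inner product and $(\cdot,\cdot)_{\mathcal{O}}=\sum_{e\in\mathcal{O}}(\cdot,\cdot)_{L^2(e)}$. $\nabla_h$ is the elementwise gradient. $\boldsymbol{n}_E$ is the unit outward normal to $E$. For a velocity $\boldsymbol{v}$, the upwind value $\xi^\uparrow$ on an interior face is $\xi|_{E_{k^-}}$ if $\{\boldsymbol{v}\}\cdot\boldsymbol{n}_e\ge0$ and $\xi|_{E_{k^+}}$ otherwise; on a boundary face $\xi^\uparrow$ is the trace of $\xi$. $\partial E_-^{\boldsymbol{v}}=\{\boldsymbol{x}\in\partial E:\{\boldsymbol{v}(\boldsymbol{x})\}\cdot\boldsymbol{n}_E<0\}$, and superscripts int/ext denote traces on $\partial E$ from inside/outside $E$ (the exterior trace on $\partial\Omega$ is taken to be $0$). $\sigma>0$ denotes penalty parameters, possibly different for different forms. **Forms.** $a_{\mathrm{diff}}(\xi,\chi)=(\nabla_h\xi,\nabla_h\chi)-(\{\nabla_h\xi\cdot\boldsymbol{n}_e\},[\chi])_{\Gamma_h}-(\{\nabla_h\chi\cdot\boldsymbol{n}_e\},[\xi])_{\Gamma_h}+\frac{\sigma}{h}([\xi],[\chi])_{\Gamma_h}$;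 for $S\in\{\partial\Omega^{\mathrm{in}},\partial\Omega^{\mathrm{out}}\}$: $a_{\mathrm{diff},S}(\xi,\chi)=a_{\mathrm{diff}}(\xi,\chi)-(\nabla_h\xi\cdot\boldsymbol{n}_e,\chi)_S-(\nabla_h\chi\cdot\boldsymbol{n}_e,\xi)_S+\frac{\sigma}{h}(\xi,\chi)_S$; $a_{\mathrm{adv}}(\xi,\boldsymbol{v},\chi)=-(\xi,\boldsymbol{v}\cdot\nabla_h\chi)+(\xi^\uparrow\{\boldsymbol{v}\cdot\boldsymbol{n}_e\},[\chi])_{\Gamma_h}$; $a_{\mathrm{reac}}(\rho,\boldsymbol{v};\boldsymbol{z},\boldsymbol{\theta})=(\boldsymbol{v}\cdot\nabla_h(\rho\boldsymbol{z}),\boldsymbol{\theta})+\frac12(\nabla_h\cdot\boldsymbol{v},\rho\boldsymbol{z}\cdot\boldsymbol{\theta})-\frac12([\boldsymbol{v}\cdot\boldsymbol{n}_e],\{\rho\boldsymbol{z}\cdot\boldsymbol{\theta}\})_{\Gamma_h\cup\partial\Omega^{\mathrm{in}}}+\sum_{E}(|\{\boldsymbol{v}\}\cdot\boldsymbol{n}_E|,((\rho\boldsymbol{z})^{\mathrm{int}}-(\rho\boldsymbol{z})^{\mathrm{ext}})\cdot\boldsymbol{\theta})_{\partial E_-^{\boldsymbol{v}}}$; $a_{\mathrm{ellip}}(\boldsymbol{z},\boldsymbol{\theta})=(\nabla_h\boldsymbol{z},\nabla_h\boldsymbol{\theta})-(\{(\nabla_h\boldsymbol{z})\boldsymbol{n}_e\},[\boldsymbol{\theta}])_{\Gamma_h}+(\{(\nabla_h\boldsymbol{\theta})\boldsymbol{n}_e\},[\boldsymbol{z}])_{\Gamma_h}+\frac{\sigma}{h}([\boldsymbol{z}],[\boldsymbol{\theta}])_{\Gamma_h}-((\nabla_h\boldsymbol{z})\boldsymbol{n}_e,\boldsymbol{\theta})_{\partial\Omega^{\mathrm{in}}}+((\nabla_h\boldsymbol{\theta})\boldsymbol{n}_e,\boldsymbol{z})_{\partial\Omega^{\mathrm{in}}}+\frac{\sigma}{h}(\boldsymbol{z},\boldsymbol{\theta})_{\partial\Omega^{\mathrm{in}}}$;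 $b_{\mathrm{diff}}(\xi;\chi)=-(c_D,\nabla_h\chi\cdot\boldsymbol{n}_e)_{\partial\Omega^{\mathrm{in}}}+\frac{\sigma}{h}(c_D,\chi)_{\partial\Omega^{\mathrm{in}}}-\frac{\sqrt2\,\delta\cos\theta}{2\,\mathrm{Cn}}(\xi^2-1,\chi)_{\partial\Omega^{\mathrm{wall}}\cup\partial\Omega^{\mathrm{out}}}$; $b_{\mathrm{pres}}(p,\phi;\boldsymbol{\theta})=-(p,\nabla_h\cdot\boldsymbol{\theta})+(\{p\},[\boldsymbol{\theta}\cdot\boldsymbol{n}_e])_{\Gamma_h\cup\partial\Omega}+(\nabla_h\phi,\boldsymbol{\theta})$; $b_{\mathrm{vel}}(\boldsymbol{\theta})=-(\boldsymbol{v}_D\cdot\boldsymbol{n},\boldsymbol{v}_D\cdot\boldsymbol{\theta})_{\partial\Omega^{\mathrm{in}}}-\frac1{\mathrm{Re}}((\nabla_h\boldsymbol{\theta})\boldsymbol{n}_e,\boldsymbol{v}_D)_{\partial\Omega^{\mathrm{in}}}+\frac{\sigma}{h\,\mathrm{Re}}(\boldsymbol{v}_D,\boldsymbol{\theta})_{\partial\Omega^{\mathrm{in}}}$; $b_{\mathrm{dens}}(\rho,\phi;\chi)=((1-\frac{\rho_{\mathrm{ref}}}{\rho})\nabla_h\phi,\nabla_h\chi)-([(1-\frac{\rho_{\mathrm{ref}}}{\rho})(\nabla_h\phi\cdot\boldsymbol{n}_e)\chi],1)_{\Gamma_h\cup\partial\Omega^{\mathrm{out}}}$. **Scheme.** Initialization: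 $p_h^0=\phi_h^0=0$; $\boldsymbol{v}_h^0=\boldsymbol{u}_h^0$ is the $L^2$ projection of $\boldsymbol{v}^0$; $c_h^0$ is the slope limiter $\mathcal{S}$ (below) applied to the $L^2$ projection of $c^0$ on $X_h$; $\rho_h^0=\rho(c_h^0)$. For $n=1,\dots,N_T$: 1. Find $(c_h^n,\mu_h^n)\in X_h^2$ such that for all $\chi_h\in X_h$: $(c_h^n,\chi_h)+\frac{\tau}{\mathrm{Pe}}a_{\mathrm{diff}}(\mu_h^n,\chi_h)+\tau a_{\mathrm{adv}}(c_h^n,\boldsymbol{u}_h^{n-1},\chi_h)=(c_h^{n-1},\chi_h)-\tau(c_D\boldsymbol{u}_h^{n-1}\cdot\boldsymbol{n}_e,\chi_h)_{\partial\Omega^{\mathrm{in}}}$ and $\mathrm{Cn}^2a_{\mathrm{diff},\partial\Omega^{\mathrm{in}}}(c_h^n,\chi_h)-(\mu_h^n,\chi_h)+(\Phi_+'(c_h^n),\chi_h)=\mathrm{Cn}^2b_{\mathrm{diff}}(c_h^{n-1};\chi_h)-(\Phi_-'(c_h^{n-1}),\chi_h)$. 2. Replace $c_h^n\leftarrow\mathcal{S}(\mathcal{L}(c_h^{n-1},c_h^n,\mu_h^n,\boldsymbol{u}_h^{n-1}))$ (below). From here on $c_h^n$ denotes this post-processed function. 3. Redefine $\mu_h^n$ by $(\mu_h^n,\chi_h)=\mathrm{Cn}^2a_{\mathrm{diff},\partial\Omega^{\mathrm{in}}}(c_h^n,\chi_h)+(\Phi_+'(c_h^n),\chi_h)-\mathrm{Cn}^2b_{\mathrm{diff}}(c_h^n;\chi_h)+(\Phi_-'(c_h^n),\chi_h)$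 for all $\chi_h\in X_h$. 4. $\rho_h^n=\rho(c_h^n)$. 5. Find $\boldsymbol{v}_h^n\in\boldsymbol{X}_h$ such that for all $\boldsymbol{\theta}_h\in\boldsymbol{X}_h$: $(\rho_h^n\boldsymbol{v}_h^n,\boldsymbol{\theta}_h)+\tau a_{\mathrm{reac}}(\rho_h^n,\boldsymbol{v}_h^{n-1};\boldsymbol{v}_h^n,\boldsymbol{\theta}_h)+\frac{\tau}{\mathrm{Re}}a_{\mathrm{ellip}}(\boldsymbol{v}_h^n,\boldsymbol{\theta}_h)=(\rho_h^{n-1}\boldsymbol{v}_h^{n-1},\boldsymbol{\theta}_h)-\frac{\tau}{\mathrm{Re}\,\mathrm{Ca}}b_{\mathrm{pres}}(p_h^{n-1},\phi_h^{n-1};\boldsymbol{\theta}_h)+\frac{3\tau}{2\sqrt2\,\mathrm{Re}\,\mathrm{Ca}\,\mathrm{Cn}}(\mu_h^n\nabla_hc_h^n,\boldsymbol{\theta}_h)+\tau b_{\mathrm{vel}}(\boldsymbol{\theta}_h)$. 6. Find $\phi_h^n\in X_h$ such that for all $\chi_h\in X_h$: $a_{\mathrm{diff},\partial\Omega^{\mathrm{out}}}(\phi_h^n,\chi_h)=b_{\mathrm{dens}}(\rho_h^n,\phi_h^{n-1};\chi_h)-\frac{\mathrm{Re}\,\mathrm{Ca}\,\rho_{\mathrm{ref}}}{\tau}(\nabla_h\cdot\boldsymbol{v}_h^n,\chi_h)$. 7. Find $(p_h^n,\boldsymbol{u}_h^n)\in X_h\times\boldsymbol{X}_h$ such that for all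 $(\chi_h,\boldsymbol{\theta}_h)\in X_h\times\boldsymbol{X}_h$: $(p_h^n,\chi_h)=(p_h^{n-1},\chi_h)+(\phi_h^n,\chi_h)-\frac23\mathrm{Ca}(\nabla_h\cdot\boldsymbol{v}_h^n,\chi_h)$ and $(\boldsymbol{u}_h^n,\boldsymbol{\theta}_h)+(\nabla_h\cdot\boldsymbol{u}_h^n,\nabla_h\cdot\boldsymbol{\theta}_h)=(\boldsymbol{v}_h^n,\boldsymbol{\theta}_h)-\frac{\tau}{\mathrm{Re}\,\mathrm{Ca}\,\rho_{\mathrm{ref}}}(\nabla_h\phi_h^n+(\frac{\rho_{\mathrm{ref}}}{\rho_h^n}-1)\nabla_h\phi_h^{n-1},\boldsymbol{\theta}_h)$. **Flux limiter $\mathcal{L}(c_h^{n-1},c_h^n,\mu_h^n,\boldsymbol{u}_h^{n-1})$.** (i) Compute cell averages $\bar c_{h,E}^{n-1}=\frac1{|E|}\int_Ec_h^{n-1}$, $\bar c_{h,E}^{n}=\frac1{|E|}\int_Ec_h^{n}$. (ii) For each $E$ and face $e\subset\partial E$ define the flux $\mathcal{H}_E(e)$: if $e=\partial E\cap\partial E'\in\Gamma_h$, $\mathcal{H}_E(e)=-\frac1{\mathrm{Pe}}\int_e\{\nabla\mu_h^n\}\cdot\boldsymbol{n}_E+\int_e(c_h^n)^\uparrow\{\boldsymbol{u}_h^{n-1}\}\cdot\boldsymbol{n}_E+\frac{\sigma}{\mathrm{Pe}\,h}\int_e(\mu_h^n|_E-\mu_h^n|_{E'})$; if $e\subset\partial\Omega^{\mathrm{in}}$,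 $\mathcal{H}_E(e)=\int_ec_D\boldsymbol{u}_h^{n-1}\cdot\boldsymbol{n}_E$; if $e\subset\partial\Omega^{\mathrm{wall}}$, $\mathcal{H}_E(e)=0$; if $e\subset\partial\Omega^{\mathrm{out}}$, $\mathcal{H}_E(e)=\int_e(c_h^n)^\uparrow\boldsymbol{u}_h^{n-1}\cdot\boldsymbol{n}_E$. Upwinding is with respect to $\boldsymbol{u}_h^{n-1}$. (iii) Compute $\bar c_{h,E}^{\mathrm{post}}=\mathcal{L}_a(E,\bar c_{h,E}^{n-1},\mathcal{H}_E)$ for all $E$. (iv) Output the function equal on each $E$ to $c_h^n|_E-\bar c_{h,E}^n+\bar c_{h,E}^{\mathrm{post}}$. **Iterative algorithm $\mathcal{L}_a$** (run simultaneously on all elements, with fixed tolerances $\epsilon_1,\epsilon_2>0$). Start: $m=1$, $\bar c_{h,E}^{(0)}=\bar c_{h,E}^{n-1}$, $\mathcal{H}_E^{(0)}=\mathcal{H}_E$, $\mathcal{H}_E^{(-1)}=0$, $\alpha_E(e)=1$. At step $m$: set $P_E^+=\tau\sum_{e\subset\partial E}\max(0,-\mathcal{H}_E^{(m-1)}(e))$, $Q_E^+=|E|(c^\ast-\bar c_{h,E}^{(m-1)})$, $P_E^-=\tau\sum_{e\subset\partial E}\min(0,-\mathcal{H}_E^{(m-1)}(e))$, $Q_E^-=|E|(c_\ast-\bar c_{h,E}^{(m-1)})$, and $\alpha_E^\pm=\min(1,Q_E^\pm/P_E^\pm)$. For an interior face $e=\partial E\cap\partial E'$: $\alpha_E(e)=\min(\alpha_E^+,\alpha_{E'}^-)$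 if $\mathcal{H}_E^{(m-1)}(e)<0$, and $\alpha_E(e)=\min(\alpha_E^-,\alpha_{E'}^+)$ if $\mathcal{H}_E^{(m-1)}(e)>0$. For a boundary face: $\alpha_E(e)=\alpha_E^+$ if $\mathcal{H}_E^{(m-1)}(e)<0$, and $\alpha_E(e)=\alpha_E^-$ if $\mathcal{H}_E^{(m-1)}(e)>0$. If $\mathcal{H}_E^{(m-1)}(e)=0$, $\alpha_E(e)$ is not updated. Then $\bar c_{h,E}^{(m)}=\bar c_{h,E}^{(m-1)}-\frac{\tau}{|E|}\sum_{e\subset\partial E}\alpha_E(e)\mathcal{H}_E^{(m-1)}(e)$ and $\mathcal{H}_E^{(m)}(e)=(1-\alpha_E(e))\mathcal{H}_E^{(m-1)}(e)$. If $\max_E\max_{e\subset\partial E}|\mathcal{H}_E^{(m)}(e)|<\epsilon_1$ or $\max_E\max_{e\subset\partial E}|\mathcal{H}_E^{(m)}(e)-\mathcal{H}_E^{(m-1)}(e)|<\epsilon_2$, stop with $\bar c_{h,E}^{\mathrm{post}}=\bar c_{h,E}^{(m)}$; otherwise increase $m$ by one and repeat. **Slope limiter $\mathcal{S}(c)$.** An element $E$ is troubled if $c(\boldsymbol{x})\notin[c_\ast,c^\ast]$ for some $\boldsymbol{x}\in E$. Untroubled elements are unchanged. On a troubled element with cell average $\bar c$ and barycenter $\boldsymbol{x}_c$: if $r\ge2$, $c|_E$ is first replaced by a linear polynomial with the same cell average (for instance by $L^2$ projection); then $c|_E$ is replaced by $\bar c+\beta_E\nabla c(\boldsymbol{x}_c)\cdot(\boldsymbol{x}-\boldsymbol{x}_c)$,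 where $\beta_E\in[0,1]$ is the largest factor for which this function lies in $[c_\ast,c^\ast]$ at all vertices of $E$. *)

(* Defs.v *)
From HB Require Import structures.
From mathcomp Require Import all_boot all_order all_algebra.
From mathcomp Require Import all_classical all_reals all_analysis.

Set Implicit Arguments.
Unset Strict Implicit.
Unset Printing Implicit Defensive.

Import Order.TTheory GRing.Theory Num.Theory numFieldNormedType.Exports.

Local Open Scope classical_set_scope.
Local Open Scope ring_scope.

(** Points and vectors of R^3 are row vectors ['rV[R]_3]. *)

Section Geometry.
Context {R : realType}.

Definition dot (u w : 'rV[R]_3) : R := \sum_a u 0 a * w 0 a.

Definition cube (x0 : 'rV[R]_3) (l : R) : set 'rV[R]_3 :=
  [set x | forall a, x0 0 a <= x 0 a <= x0 0 a + l].

Definition open_cube (x0 : 'rV[R]_3) (l : R) : set 'rV[R]_3 :=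
  [set x | forall a, x0 0 a < x 0 a < x0 0 a + l].

(* Lebesgue measure on R^3 and R^2 is the product of the one on R; [pt3] carries
   R * R * R to row vectors, and [face_pt a t] parametrizes the plane {x_a = t}
   by its two remaining coordinates. *)
Definition pt3 (p : measurableTypeR R * measurableTypeR R * measurableTypeR R) :
    'rV[R]_3 :=
  \row_a tnth [tuple (p.1.1 : R); (p.1.2 : R); (p.2 : R)] a.

Definition face_pt (a : 'I_3) (t : R)
    (q : measurableTypeR R * measurableTypeR R) : 'rV[R]_3 :=
  \row_b if unlift a b is Some j
         then tnth [tuple (q.1 : R); (q.2 : R)] j else t.

Definition int3 (A : set 'rV[R]_3) (F : 'rV[R]_3 -> R) : R :=
  \int[(@lebesgue_measure R \x @lebesgue_measure R \x @lebesgue_measure R)%E]_(p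
    in pt3 @^-1` A) F (pt3 p).

Definition vol3 (A : set 'rV[R]_3) : R :=
  fine ((@lebesgue_measure R \x @lebesgue_measure R \x @lebesgue_measure R)%E
    (pt3 @^-1` A)).

Definition int_plane (a : 'I_3) (t : R) (A : set 'rV[R]_3)
    (F : 'rV[R]_3 -> R) : R :=
  \int[(@lebesgue_measure R \x @lebesgue_measure R)%E]_(q
    in face_pt a t @^-1` A) F (face_pt a t q).

Definition diameter (A : set 'rV[R]_3) : R :=
  sup [set Num.sqrt (dot (x - y) (x - y)) | x in A & y in A].

Definition grad (f : 'rV[R]_3 -> R) (x : 'rV[R]_3) : 'rV[R]_3 :=
  \row_a 'D_(delta_mx 0 a) f x.

Definition jac (w : 'rV[R]_3 -> 'rV[R]_3) (x : 'rV[R]_3) : 'M[R]_3 :=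
  \matrix_(i, a) 'D_(delta_mx 0 a) (fun y => w y 0 i) x.

Definition divg (w : 'rV[R]_3 -> 'rV[R]_3) (x : 'rV[R]_3) : R := \tr (jac w x).

(* The vector with components \sum_a n_a * d_a w_i, written (grad w) n, and
   also n . grad w. *)
Definition dirder (w : 'rV[R]_3 -> 'rV[R]_3) (n x : 'rV[R]_3) : 'rV[R]_3 :=
  n *m (jac w x)^T.

Definition Qpoly (r : nat) (f : 'rV[R]_3 -> R) : Prop :=
  exists a : {ffun 'I_3 -> 'I_r.+1} -> R, forall x,
    f x = \sum_m a m * \prod_(i < 3) x 0 i ^+ m i.

Definition affine_fun (f : 'rV[R]_3 -> R) : Prop :=
  exists (b : R) (g : 'rV[R]_3), forall x, f x = b + dot g x.

End Geometry.

(** The axes are aligned with the edges of the cubes. The element E_k is the cube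
    with lowest corner [corner k]; [mesh_conforming] says that elements that
    touch share a whole face, edge or vertex. *)
Record cube_mesh (R : realType) := CubeMesh {
  nelt : nat;
  side : R;
  corner : 'I_nelt -> 'rV[R]_3;
  side_gt0 : 0 < side;
  mesh_disjoint : forall i j, i != j ->
    open_cube (corner i) side `&` open_cube (corner j) side = set0;
  mesh_conforming : forall i j,
    cube (corner i) side `&` cube (corner j) side !=set0 ->
    forall a, corner j 0 a - corner i 0 a \in [:: - side; 0; side] }.

(* A face of a cube: its normal axis, and its side (true = upper). *)
Definition face := ('I_3 * bool)%type.

Inductive bkind := Wall | Inflow | Outflow.

Definition is_inflow b := if b is Inflow then true else false.
Definition is_outflow b := if b is Outflow then true else false.
Definition is_wall_or_outflow b := ~~ is_inflow b.

Section Mesh.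
Context {R : realType} (M : cube_mesh R).

Definition elt (k : 'I_(nelt M)) : set 'rV[R]_3 := cube (corner k) (side M).

Definition elt_int (k : 'I_(nelt M)) : set 'rV[R]_3 :=
  open_cube (corner k) (side M).

Definition Omega : set 'rV[R]_3 := interior (\bigcup_k elt k).

Definition mesh_size : R := \big[Num.max/0]_k diameter (elt k).

(* Volume integrals are taken over the open elements, so that data given in
   Omega are not evaluated on its boundary. *)
Definition int_elt (k : 'I_(nelt M)) (F : 'rV[R]_3 -> R) : R :=
  int3 (elt_int k) F.

Definition vol (k : 'I_(nelt M)) : R := vol3 (elt_int k).

Definition cell_avg (k : 'I_(nelt M)) (f : 'rV[R]_3 -> R) : R :=
  (vol k)^-1 * int_elt k f.

Definition barycenter (k : 'I_(nelt M)) : 'rV[R]_3 :=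
  corner k + const_mx (side M / 2).

Definition vertex (k : 'I_(nelt M)) (s : {ffun 'I_3 -> bool}) : 'rV[R]_3 :=
  corner k + \row_a ((s a)%:R * side M).

(* Unit normal to the face f, outward to the cube. *)
Definition normal (f : face) : 'rV[R]_3 := (-1) ^+ (~~ f.2) *: delta_mx 0 f.1.

Definition int_face (k : 'I_(nelt M)) (f : face) (F : 'rV[R]_3 -> R) : R :=
  int_plane f.1 (corner k 0 f.1 + f.2%:R * side M) (elt k) F.

(* The element on the other side of the face f of E_k; None on the boundary of
   Omega. *)
Definition nbr (k : 'I_(nelt M)) (f : face) : option 'I_(nelt M) :=
  [pick k' | corner k' == corner k + side M *: normal f].

(* An element of X_h is given by its polynomial on each element, extended to the
   whole of R^3, so that the trace from E_k at x is [xi k x] and derivatives make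
   sense on faces. *)
Definition dfun := 'I_(nelt M) -> 'rV[R]_3 -> R.
Definition vdfun := 'I_(nelt M) -> 'rV[R]_3 -> 'rV[R]_3.

Definition Xh (r : nat) (xi : dfun) : Prop := forall k, Qpoly r (xi k).
Definition Xh3 (r : nat) (w : vdfun) : Prop :=
  forall i : 'I_3, Xh r (fun k x => w k x 0 i).

Definition avg (g : 'I_(nelt M) -> R) (i j : 'I_(nelt M)) : R := (g i + g j) / 2.
Definition jump (g : 'I_(nelt M) -> R) (i j : 'I_(nelt M)) : R := g i - g j.
Definition avgv (g : 'I_(nelt M) -> 'rV[R]_3) (i j : 'I_(nelt M)) : 'rV[R]_3 :=
  2^-1 *: (g i + g j).
Definition jumpv (g : 'I_(nelt M) -> 'rV[R]_3) (i j : 'I_(nelt M)) : 'rV[R]_3 :=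
  g i - g j.

Definition int_Omega (F : dfun) : R := \sum_k int_elt k (F k).

(* Each interior face is visited once, from E_i = E_{k-} to E_j = E_{k+}; the
   third argument of the integrand is n_e. *)
Definition int_Gamma
    (F : 'I_(nelt M) -> 'I_(nelt M) -> 'rV[R]_3 -> 'rV[R]_3 -> R) : R :=
  \sum_(i < nelt M) \sum_(j < nelt M | (i < j)%N)
    \sum_(f : face | nbr i f == Some j)
    int_face i f (F i j (normal f)).

(* [bc k f] is meaningful only if [nbr k f = None]. *)
Definition int_bnd (bc : 'I_(nelt M) -> face -> bkind) (S : pred bkind)
    (F : 'I_(nelt M) -> 'rV[R]_3 -> 'rV[R]_3 -> R) : R :=
  \sum_k \sum_(f : face | (nbr k f == None) && S (bc k f))
    int_face k f (F k (normal f)).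

(* Upwind value at a point x of the face from E_i to E_j with normal n. *)
Definition upwind (xi : dfun) (v : vdfun) (i j : 'I_(nelt M))
    (n x : 'rV[R]_3) : R :=
  if 0 <= dot (avgv (v^~ x) i j) n then xi i x else xi j x.

End Mesh.

Record physical_constants (R : realType) := PhysicalConstants {
  Pe : R; Cn : R; Re : R; Ca : R; rhoA : R; rhoB : R; rho_ref : R;
  Pe_gt0 : 0 < Pe; Cn_gt0 : 0 < Cn; Re_gt0 : 0 < Re; Ca_gt0 : 0 < Ca;
  rhoA_gt0 : 0 < rhoA; rhoB_gt0 : 0 < rhoB; rho_ref_gt0 : 0 < rho_ref }.

(* One penalty for each form: a_diff in the mass balance, the interface fluxes of
   the flux limiter, a_{diff,in}, b_diff, a_ellip, b_vel and a_{diff,out}. *)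
Record penalties (R : realType) := Penalties {
  sg_diff : R; sg_flux : R; sg_diff_in : R; sg_bdiff : R;
  sg_ellip : R; sg_bvel : R; sg_diff_out : R;
  sg_diff_gt0 : 0 < sg_diff; sg_flux_gt0 : 0 < sg_flux;
  sg_diff_in_gt0 : 0 < sg_diff_in; sg_bdiff_gt0 : 0 < sg_bdiff;
  sg_ellip_gt0 : 0 < sg_ellip; sg_bvel_gt0 : 0 < sg_bvel;
  sg_diff_out_gt0 : 0 < sg_diff_out }.

Record problem_data (R : realType) := ProblemData {
  c_init : 'rV[R]_3 -> R;
  v_init : 'rV[R]_3 -> 'rV[R]_3;
  c_D : 'rV[R]_3 -> R;
  v_D : 'rV[R]_3 -> 'rV[R]_3;
  theta_c : 'rV[R]_3 -> R; (* contact angle *)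
  delta_c : 'rV[R]_3 -> R }.

Section Forms.
Context {R : realType} (M : cube_mesh R).
Variables (bc : 'I_(nelt M) -> face -> bkind) (ph : physical_constants R)
  (dat : problem_data R).
Implicit Types (xi chi rho phi p mu : dfun M) (v w z th : vdfun M) (sg : R).

Local Notation h := (mesh_size M).

Definition Phi_plus (c : R) : R := 4^-1 * (1 + c ^+ 4).
Definition Phi_minus (c : R) : R := - (2^-1 * c ^+ 2).

Definition density (c : dfun M) : dfun M := fun k x =>
  (1 + c k x) / 2 * rhoA ph + (1 - c k x) / 2 * rhoB ph.

Definition scalev (rho : dfun M) (z : vdfun M) : vdfun M :=
  fun k x => rho k x *: z k x.

Definition a_diff sg xi chi : R :=
  int_Omega (fun k x => dot (grad (xi k) x) (grad (chi k) x))
  - int_Gamma (fun i j n x =>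
      avg (fun k => dot (grad (xi k) x) n) i j * jump (chi^~ x) i j)
  - int_Gamma (fun i j n x =>
      avg (fun k => dot (grad (chi k) x) n) i j * jump (xi^~ x) i j)
  + sg / h * int_Gamma (fun i j _ x => jump (xi^~ x) i j * jump (chi^~ x) i j).

Definition a_diffS sg (S : pred bkind) xi chi : R :=
  a_diff sg xi chi
  - int_bnd bc S (fun k n x => dot (grad (xi k) x) n * chi k x)
  - int_bnd bc S (fun k n x => dot (grad (chi k) x) n * xi k x)
  + sg / h * int_bnd bc S (fun k _ x => xi k x * chi k x).

Definition a_adv xi v chi : R :=
  - int_Omega (fun k x => xi k x * dot (v k x) (grad (chi k) x))
  + int_Gamma (fun i j n x =>
      upwind xi v i j n x * avg (fun k => dot (v k x) n) i j
      * jump (chi^~ x) i j).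

(* Average of v on the face f of E_k, equal to the trace on the boundary, and
   trace of w from outside E_k, equal to 0 on the boundary. *)
Definition face_avg v (k : 'I_(nelt M)) (f : face) (x : 'rV[R]_3) : 'rV[R]_3 :=
  if nbr k f is Some k' then avgv (v^~ x) k k' else v k x.

Definition ext_trace w (k : 'I_(nelt M)) (f : face) (x : 'rV[R]_3) : 'rV[R]_3 :=
  if nbr k f is Some k' then w k' x else 0.

Definition a_reac rho v z th : R :=
  let w := scalev rho z in
  int_Omega (fun k x => dot (dirder (w k) (v k x) x) (th k x))
  + 2^-1 * int_Omega (fun k x => divg (v k) x * dot (w k x) (th k x))
  - 2^-1 * (int_Gamma (fun i j n x =>
              jump (fun k => dot (v k x) n) i j
              * avg (fun k => dot (w k x) (th k x)) i j)
            + int_bnd bc is_inflow (fun k n x =>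
                dot (v k x) n * dot (w k x) (th k x)))
  + \sum_k \sum_(f : face) int_face k f (fun x =>
      let vn := dot (face_avg v k f x) (normal f) in
      if vn < 0 then `|vn| * dot (w k x - ext_trace w k f x) (th k x) else 0).

Definition a_ellip sg z th : R :=
  int_Omega (fun k x => \sum_i \sum_a jac (z k) x i a * jac (th k) x i a)
  - int_Gamma (fun i j n x =>
      dot (avgv (fun k => dirder (z k) n x) i j) (jumpv (th^~ x) i j))
  + int_Gamma (fun i j n x =>
      dot (avgv (fun k => dirder (th k) n x) i j) (jumpv (z^~ x) i j))
  + sg / h * int_Gamma (fun i j _ x =>
      dot (jumpv (z^~ x) i j) (jumpv (th^~ x) i j))
  - int_bnd bc is_inflow (fun k n x => dot (dirder (z k) n x) (th k x))
  + int_bnd bc is_inflow (fun k n x => dot (dirder (th k) n x) (z k x))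
  + sg / h * int_bnd bc is_inflow (fun k _ x => dot (z k x) (th k x)).

Definition b_diff sg xi chi : R :=
  - int_bnd bc is_inflow (fun k n x => c_D dat x * dot (grad (chi k) x) n)
  + sg / h * int_bnd bc is_inflow (fun k _ x => c_D dat x * chi k x)
  - int_bnd bc is_wall_or_outflow (fun k _ x =>
      Num.sqrt 2 * delta_c dat x * cos (theta_c dat x) / (2 * Cn ph)
      * (xi k x ^+ 2 - 1) * chi k x).

Definition b_pres p phi th : R :=
  - int_Omega (fun k x => p k x * divg (th k) x)
  + (int_Gamma (fun i j n x =>
       avg (p^~ x) i j * jump (fun k => dot (th k x) n) i j)
     + int_bnd bc predT (fun k n x => p k x * dot (th k x) n))
  + int_Omega (fun k x => dot (grad (phi k) x) (th k x)).

Definition b_vel sg th : R :=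
  - int_bnd bc is_inflow (fun k n x =>
      dot (v_D dat x) n * dot (v_D dat x) (th k x))
  - (Re ph)^-1 * int_bnd bc is_inflow (fun k n x =>
      dot (dirder (th k) n x) (v_D dat x))
  + sg / (h * Re ph) * int_bnd bc is_inflow (fun k _ x =>
      dot (v_D dat x) (th k x)).

Definition b_dens rho phi chi : R :=
  int_Omega (fun k x =>
    (1 - rho_ref ph / rho k x) * dot (grad (phi k) x) (grad (chi k) x))
  - (int_Gamma (fun i j n x =>
       jump (fun k =>
         (1 - rho_ref ph / rho k x) * dot (grad (phi k) x) n * chi k x) i j)
     + int_bnd bc is_outflow (fun k n x =>
         (1 - rho_ref ph / rho k x) * dot (grad (phi k) x) n * chi k x)).

End Forms.

Section Limiters.
Context {R : realType} (M : cube_mesh R).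
Variables (bc : 'I_(nelt M) -> face -> bkind) (ph : physical_constants R)
  (dat : problem_data R).

Definition c_min : R := -1.
Definition c_max : R := 1.

(* The flux H_E(e) for E = E_k and e its face f. The upwind value is computed
   with the normal n_e, which is n_E only if E has the lower number. *)
Definition flux (sg : R) (c mu : dfun M) (u : vdfun M)
    (k : 'I_(nelt M)) (f : face) : R :=
  let nE := normal f in
  match nbr k f with
  | Some k' =>
      - (Pe ph)^-1 * int_face k f (fun x =>
          dot (avgv (fun l => grad (mu l) x) k k') nE)
      + int_face k f (fun x =>
          (if (k < k')%N then upwind c u k k' nE x else upwind c u k' k (- nE) x)
          * dot (avgv (u^~ x) k k') nE)
      + sg / (Pe ph * mesh_size M) * int_face k f (fun x => mu k x - mu k' x)
  | None =>
      match bc k f with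
      | Inflow => int_face k f (fun x => c_D dat x * dot (u k x) nE)
      | Wall => 0
      | Outflow => int_face k f (fun x => c k x * dot (u k x) nE)
      end
  end.

Record limiter_state := LimiterState {
  st_avg : 'I_(nelt M) -> R;
  st_flux : 'I_(nelt M) -> face -> R;
  st_alpha : 'I_(nelt M) -> face -> R }.

(* min(1, Q/P), with Q/0 read as +oo. *)
Definition limiter_ratio (Q P : R) : R :=
  if P == 0 then 1 else Num.min 1 (Q / P).

Definition limiter_step (tau : R) (s : limiter_state) : limiter_state :=
  let H := st_flux s in
  let Pp k := tau * \sum_(f : face) Num.max 0 (- H k f) in
  let Qp k := vol k * (c_max - st_avg s k) in
  let Pm k := tau * \sum_(f : face) Num.min 0 (- H k f) in
  let Qm k := vol k * (c_min - st_avg s k) in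
  let ap k := limiter_ratio (Qp k) (Pp k) in
  let am k := limiter_ratio (Qm k) (Pm k) in
  let alpha k f :=
    if H k f < 0 then
      if nbr k f is Some k' then Num.min (ap k) (am k') else ap k
    else if 0 < H k f then
      if nbr k f is Some k' then Num.min (am k) (ap k') else am k
    else st_alpha s k f in
  LimiterState
    (fun k => st_avg s k - tau / vol k * (\sum_(f : face) alpha k f * H k f))
    (fun k f => (1 - alpha k f) * H k f)
    alpha.

Definition limiter_iter (tau : R) (cbar : 'I_(nelt M) -> R)
    (H : 'I_(nelt M) -> face -> R) (m : nat) : limiter_state :=
  iter m (limiter_step tau) (LimiterState cbar H (fun _ _ => 1)).

Definition limiter_stop (tau eps1 eps2 : R) (cbar : 'I_(nelt M) -> R)
    (H : 'I_(nelt M) -> face -> R) (m : nat) : Prop :=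
  let Hm := st_flux (limiter_iter tau cbar H m) in
  let Hm1 := st_flux (limiter_iter tau cbar H m.-1) in
  \big[Num.max/0]_k \big[Num.max/0]_(f : face) `|Hm k f| < eps1 \/
  \big[Num.max/0]_k \big[Num.max/0]_(f : face) `|Hm k f - Hm1 k f| < eps2.

Definition limiter_output (tau eps1 eps2 : R) (cbar : 'I_(nelt M) -> R)
    (H : 'I_(nelt M) -> face -> R) (cpost : 'I_(nelt M) -> R) : Prop :=
  exists m : nat,
    [/\ (0 < m)%N, limiter_stop tau eps1 eps2 cbar H m,
        forall l : nat, (0 < l < m)%N -> ~ limiter_stop tau eps1 eps2 cbar H l
      & cpost = st_avg (limiter_iter tau cbar H m)].

Definition flux_limited (tau eps1 eps2 sg : R) (c_old c mu : dfun M)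
    (u : vdfun M) (c' : dfun M) : Prop :=
  exists cpost : 'I_(nelt M) -> R,
    limiter_output tau eps1 eps2 (fun k => cell_avg k (c_old k))
      (flux sg c mu u) cpost /\
    forall k x, c' k x = c k x - cell_avg k (c k) + cpost k.

Definition troubled (k : 'I_(nelt M)) (f : 'rV[R]_3 -> R) : Prop :=
  exists2 x, elt k x & ~~ (c_min <= f x <= c_max).

Definition slope_fun (k : 'I_(nelt M)) (f : 'rV[R]_3 -> R) (b : R)
    (x : 'rV[R]_3) : R :=
  cell_avg k f + b * dot (grad f (barycenter k)) (x - barycenter k).

(* The set is compact, so that its supremum is its largest element whenever it is
   nonempty, i.e. whenever the cell average lies in [c_min, c_max]. Otherwise the
   supremum is 0 by convention: the slope limiter is then still defined, and does
   not enforce the bounds. *)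
Definition slope_factor (k : 'I_(nelt M)) (f : 'rV[R]_3 -> R) : R :=
  sup [set b | 0 <= b <= 1 /\
    forall s, c_min <= slope_fun k f b (vertex k s) <= c_max].

Definition linearized (r : nat) (k : 'I_(nelt M)) (f g : 'rV[R]_3 -> R) : Prop :=
  if (2 <= r)%N then affine_fun g /\ cell_avg k g = cell_avg k f else g = f.

(* A relation, since the linear polynomial is not prescribed if r >= 2. *)
Definition slope_limited (r : nat) (c c' : dfun M) : Prop :=
  forall k,
    (~ troubled k (c k) -> c' k = c k) /\
    (troubled k (c k) -> exists2 g, linearized r k (c k) g &
       c' k = slope_fun k g (slope_factor k g)).

End Limiters.

(** [c_pre n] and [mu_pre n] are the solution of the nonlinear system of the n-th
    time step; [c n] and [mu n] are the final, post-processed functions. *)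
Record dg_sequences (R : realType) (M : cube_mesh R) := DGSequences {
  c_pre : nat -> dfun M;
  mu_pre : nat -> dfun M;
  c_h : nat -> dfun M;
  mu_h : nat -> dfun M;
  v_h : nat -> vdfun M;
  u_h : nat -> vdfun M;
  phi_h : nat -> dfun M;
  p_h : nat -> dfun M }.

(** The scheme; the n-th step is written with n+1 for the current time. *)
Record dg_scheme (R : realType) (M : cube_mesh R)
    (bc : 'I_(nelt M) -> face -> bkind) (r : nat) (ph : physical_constants R)
    (sg : penalties R) (dat : problem_data R) (T : R) (NT : nat)
    (eps1 eps2 : R) (S : dg_sequences M) (tau := T / NT%:R) : Prop := DGScheme {
  init_p : p_h S 0%N = (fun _ _ => 0);
  init_phi : phi_h S 0%N = (fun _ _ => 0);
  init_v : Xh3 r (v_h S 0%N) /\ forall th, Xh3 r th ->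
    int_Omega (fun k x => dot (v_h S 0%N k x) (th k x))
    = int_Omega (M := M) (fun k x => dot (v_init dat x) (th k x));
  init_u : u_h S 0%N = v_h S 0%N;
  init_c : exists2 c0 : dfun M,
    Xh r c0 /\ (forall chi, Xh r chi ->
      int_Omega (fun k x => c0 k x * chi k x)
      = int_Omega (M := M) (fun k x => c_init dat x * chi k x))
    & slope_limited r c0 (c_h S 0%N);
  step1_space : forall n, (n < NT)%N ->
    Xh r (c_pre S n.+1) /\ Xh r (mu_pre S n.+1);
  step1_mass : forall n, (n < NT)%N -> forall chi, Xh r chi ->
    int_Omega (fun k x => c_pre S n.+1 k x * chi k x)
    + tau / Pe ph * a_diff (sg_diff sg) (mu_pre S n.+1) chi
    + tau * a_adv (c_pre S n.+1) (u_h S n) chi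
    = int_Omega (fun k x => c_h S n k x * chi k x)
      - tau * int_bnd bc is_inflow (fun k nu x =>
          c_D dat x * dot (u_h S n k x) nu * chi k x);
  step1_potential : forall n, (n < NT)%N -> forall chi, Xh r chi ->
    Cn ph ^+ 2 * a_diffS bc (sg_diff_in sg) is_inflow (c_pre S n.+1) chi
    - int_Omega (fun k x => mu_pre S n.+1 k x * chi k x)
    + int_Omega (fun k x => derive1 Phi_plus (c_pre S n.+1 k x) * chi k x)
    = Cn ph ^+ 2 * b_diff bc ph dat (sg_bdiff sg) (c_h S n) chi
      - int_Omega (fun k x => derive1 Phi_minus (c_h S n k x) * chi k x);
  step2 : forall n, (n < NT)%N -> exists2 c1 : dfun M,
    flux_limited bc ph dat tau eps1 eps2 (sg_flux sg) (c_h S n) (c_pre S n.+1)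
      (mu_pre S n.+1) (u_h S n) c1
    & slope_limited r c1 (c_h S n.+1);
  step3 : forall n, (n < NT)%N -> Xh r (mu_h S n.+1) /\
    forall chi, Xh r chi ->
    int_Omega (fun k x => mu_h S n.+1 k x * chi k x)
    = Cn ph ^+ 2 * a_diffS bc (sg_diff_in sg) is_inflow (c_h S n.+1) chi
      + int_Omega (fun k x => derive1 Phi_plus (c_h S n.+1 k x) * chi k x)
      - Cn ph ^+ 2 * b_diff bc ph dat (sg_bdiff sg) (c_h S n.+1) chi
      + int_Omega (fun k x => derive1 Phi_minus (c_h S n.+1 k x) * chi k x);
  step5 : forall n, (n < NT)%N -> Xh3 r (v_h S n.+1) /\
    forall th, Xh3 r th ->
    let rho1 := density ph (c_h S n.+1) in
    let rho0 := density ph (c_h S n) in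
    int_Omega (fun k x => rho1 k x * dot (v_h S n.+1 k x) (th k x))
    + tau * a_reac bc rho1 (v_h S n) (v_h S n.+1) th
    + tau / Re ph * a_ellip bc (sg_ellip sg) (v_h S n.+1) th
    = int_Omega (fun k x => rho0 k x * dot (v_h S n k x) (th k x))
      - tau / (Re ph * Ca ph) * b_pres bc (p_h S n) (phi_h S n) th
      + 3 * tau / (2 * Num.sqrt 2 * Re ph * Ca ph * Cn ph)
        * int_Omega (fun k x =>
            mu_h S n.+1 k x * dot (grad (c_h S n.+1 k) x) (th k x))
      + tau * b_vel bc ph dat (sg_bvel sg) th;
  step6 : forall n, (n < NT)%N -> Xh r (phi_h S n.+1) /\
    forall chi, Xh r chi ->
    a_diffS bc (sg_diff_out sg) is_outflow (phi_h S n.+1) chi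
    = b_dens bc ph (density ph (c_h S n.+1)) (phi_h S n) chi
      - Re ph * Ca ph * rho_ref ph / tau
        * int_Omega (fun k x => divg (v_h S n.+1 k) x * chi k x);
  step7_p : forall n, (n < NT)%N -> Xh r (p_h S n.+1) /\
    forall chi, Xh r chi ->
    int_Omega (fun k x => p_h S n.+1 k x * chi k x)
    = int_Omega (fun k x => p_h S n k x * chi k x)
      + int_Omega (fun k x => phi_h S n.+1 k x * chi k x)
      - 2 / 3 * Ca ph * int_Omega (fun k x => divg (v_h S n.+1 k) x * chi k x);
  step7_u : forall n, (n < NT)%N -> Xh3 r (u_h S n.+1) /\
    forall th, Xh3 r th ->
    int_Omega (fun k x => dot (u_h S n.+1 k x) (th k x))
    + int_Omega (fun k x => divg (u_h S n.+1 k) x * divg (th k) x)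
    = int_Omega (fun k x => dot (v_h S n.+1 k x) (th k x))
      - tau / (Re ph * Ca ph * rho_ref ph)
        * int_Omega (fun k x =>
            dot (grad (phi_h S n.+1 k) x
                 + (rho_ref ph / density ph (c_h S n.+1) k x - 1)
                   *: grad (phi_h S n k) x)
                (th k x)) }.

(* Main.v *)
(** The mean of a function with values in [-1, 1] lies in [-1, 1]; hence so do the
    cell averages of the projected initial datum and of every c_h^n that satisfies
    the bounds. One pass of the flux limiter keeps the averages there: since
    alpha_E(e) <= alpha_E^+ on inflow faces, the average increases by at most
    alpha_E^+ P_E^+ / |E| <= Q_E^+ / |E| = 1 - avg, and symmetrically from below.
    Neither the antisymmetry of the fluxes nor their values matter. The
    flux-limited function has exactly the limited averages, and the slope limiter
    turns averages in [-1, 1] into pointwise bounds because an affine function on a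
    cube takes its extreme values at vertices. *)

Require Import Defs.
From HB Require Import structures.
From mathcomp Require Import all_boot all_order all_algebra.
From mathcomp Require Import all_classical all_reals all_analysis.
From mathcomp Require Import ring lra.

Import Order.TTheory GRing.Theory Num.Theory numFieldNormedType.Exports.

Local Open Scope classical_set_scope.
Local Open Scope ring_scope.

Set Implicit Arguments.
Unset Strict Implicit.
Unset Printing Implicit Defensive.

(** * Bounds on integrals *)

Lemma le_nonneg_integral d (T : measurableType d) (R : realType)
    (mu : {measure set T -> \bar R}) (f g : T -> \bar R) :
  (forall x, 0 <= f x)%E -> (forall x, f x <= g x)%E ->
  (\int[mu]_x f x <= \int[mu]_x g x)%E.
Proof.
move=> f0 fg; have g0 x : (0 <= g x)%E by apply: le_trans (fg x).
rewrite !ge0_integralTE//; apply: ereal_sup_le => _ [h hf <-].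
by exists h => // x; apply: le_trans (fg x).
Qed.

(* No measurability is needed: the integral of a nonnegative function is a
   supremum over the simple functions below it, hence monotone. *)
Lemma norm_Rintegral_le d (T : measurableType d) (R : realType)
    (mu : {measure set T -> \bar R}) (D : set T) (f : T -> R) (K : R) :
  measurable D -> (mu D < +oo)%E -> 0 <= K ->
  (forall x, D x -> `|f x| <= K) ->
  `|\int[mu]_(x in D) f x| <= K * fine (mu D).
Proof.
move=> mD fD K0 fK.
have muD : mu D = (fine (mu D))%:E by rewrite fineK// ge0_fin_numE.
have Kint : (\int[mu]_(x in D) (cst K%:E) x = (K * fine (mu D))%:E)%E.
  by rewrite integral_cst// EFinM -muD.
(* Used for the positive and the negative part of [f]: two numbers in [[0, K * mu D]] differ by at
   most [K * mu D]. *)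
have part (g : T -> \bar R) : (forall x, 0 <= g x)%E ->
    (forall x, D x -> g x <= K%:E)%E ->
    (0 <= \int[mu]_(x in D) g x <= (K * fine (mu D))%:E)%E.
  move=> g0 gK; rewrite integral_ge0//= -Kint.
  rewrite [leLHS]integral_mkcond [leRHS]integral_mkcond.
  apply: le_nonneg_integral => x.
    by rewrite patchE; case: ifP.
  by rewrite !patchE; case: ifP => // /set_mem/gK.
rewrite /Rintegral integralE.
have /andP[p0 pK] : (0 <= \int[mu]_(x in D) ((EFin \o f) ^\+ x)
    <= (K * fine (mu D))%:E)%E.
  apply: part => // x /fK; rewrite ler_norml => /andP[_ fxK].
  by rewrite funeposE /= ge_max !lee_fin fxK.
have /andP[n0 nK] : (0 <= \int[mu]_(x in D) ((EFin \o f) ^\- x)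
    <= (K * fine (mu D))%:E)%E.
  apply: part => // x /fK; rewrite ler_norml lerNl => /andP[fxK _].
  by rewrite funenegE /= ge_max !lee_fin fxK.
move: p0 pK n0 nK.
set a := integral _ _ _; set b := integral _ _ _.
case: a => [a| |]; case: b => [b| |] //=; rewrite !lee_fin => a0 aK b0 bK.
by rewrite ler_norml; apply/andP; split; lra.
Qed.

(** * Flux limiter and cell averages *)

Section Zalesak.
Context {R : realType}.

(** The lower ratio is formed from nonpositive data; flipping both signs brings it to the
    nonnegative case. *)
Lemma limiter_ratioN (Q P : R) : limiter_ratio (- Q) (- P) = limiter_ratio Q P.
Proof. by rewrite /limiter_ratio oppr_eq0 invrN mulrNN. Qed.

Lemma limiter_ratio_ge0 (Q P : R) : 0 <= Q -> 0 <= P -> 0 <= limiter_ratio Q P.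
Proof.
move=> Q0 P0; rewrite /limiter_ratio; case: ifP => // _.
by rewrite le_min ler01 divr_ge0.
Qed.

Lemma limiter_ratio_mul_le (Q P : R) : 0 <= Q -> 0 <= P ->
  limiter_ratio Q P * P <= Q.
Proof.
move=> Q0 P0; rewrite /limiter_ratio; have [->|nP0] := eqVneq P 0.
  by rewrite mulr0.
have Pp : 0 < P by rewrite lt_def nP0.
by rewrite -ler_pdivlMr// ge_min lexx orbT.
Qed.

Lemma sum_max0_ge0 (I : finType) (H : I -> R) : 0 <= \sum_f Num.max 0 (H f).
Proof. by apply: sumr_ge0 => f _; rewrite le_max lexx. Qed.

(** Outflow faces can only lower the left side. Inflow faces contribute at most the ratio times the
    total inflow, which is at most [Q]. It serves for both bounds, the lower one with the fluxes
    reversed. *)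
Lemma limited_inflow_le (I : finType) (H alpha : I -> R) (tau Q : R) :
  0 <= tau -> 0 <= Q ->
  (forall f, H f < 0 ->
    alpha f <= limiter_ratio Q (tau * \sum_g Num.max 0 (- H g))) ->
  (forall f, 0 < H f -> 0 <= alpha f) ->
  - (tau * \sum_f alpha f * H f) <= Q.
Proof.
move=> tau0 Q0 alpha_le alpha_ge0.
set a := limiter_ratio _ _ in alpha_le.
have P0 : 0 <= tau * \sum_g Num.max 0 (- H g).
  by rewrite mulr_ge0// (sum_max0_ge0 (fun g => - H g)).
apply: le_trans (limiter_ratio_mul_le Q0 P0); rewrite -/a.
rewrite -mulrN mulrCA ler_wpM2l// mulr_sumr -sumrN ler_sum// => f _.
have [Hneg|Hpos|->] := ltgtP (H f) 0.
- rewrite (max_idPr _) ?oppr_ge0 ?(ltW Hneg)// -mulrN.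
  by rewrite ler_wpM2r ?oppr_ge0 ?(ltW Hneg)// alpha_le.
- rewrite (max_idPl _) ?oppr_le0 ?(ltW Hpos)// mulr0 oppr_le0.
  by rewrite mulr_ge0 ?(ltW Hpos)// alpha_ge0.
- by rewrite mulr0 oppr0 maxxx mulr0.
Qed.

Lemma limiter_step_bounds (M : cube_mesh R) (tau : R) (s : limiter_state M) :
  (forall k : 'I_(nelt M), 0 < vol k) -> 0 <= tau ->
  (forall k, -1 <= st_avg s k <= 1) ->
  forall k, -1 <= st_avg (limiter_step tau s) k <= 1.
Proof.
move=> vol_gt0 tau0 sb.
have Qp0 k : 0 <= vol k * (c_max - st_avg s k).
  by rewrite mulr_ge0 ?(ltW (vol_gt0 k))// subr_ge0; case/andP: (sb k).
have Qm0 k : 0 <= - (vol k * (c_min - st_avg s k)).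
  by rewrite -mulrN opprB mulr_ge0 ?(ltW (vol_gt0 k))// subr_ge0; case/andP: (sb k).
(* The lower data are, up to sign, the upper data of the reversed fluxes. *)
have PmE k : tau * \sum_f Num.min 0 (- st_flux s k f)
    = - (tau * \sum_f Num.max 0 (- - st_flux s k f)).
  rewrite -mulrN -sumrN; congr (_ * _); apply: eq_bigr => f _.
  by rewrite oppr_max oppr0 opprK.
have ap0 k : 0 <= limiter_ratio (vol k * (c_max - st_avg s k))
    (tau * \sum_f Num.max 0 (- st_flux s k f)).
  by rewrite limiter_ratio_ge0// mulr_ge0// (sum_max0_ge0 (fun g => - st_flux s k g)).
have am0 k : 0 <= limiter_ratio (vol k * (c_min - st_avg s k))
    (tau * \sum_f Num.min 0 (- st_flux s k f)).
  rewrite -limiter_ratioN PmE opprK limiter_ratio_ge0// mulr_ge0//.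
  by rewrite (sum_max0_ge0 (fun g => - - st_flux s k g)).
move=> k; pose alpha f := st_alpha (limiter_step tau s) k f.
have -> : st_avg (limiter_step tau s) k
  = st_avg s k - tau / vol k * \sum_f alpha f * st_flux s k f by [].
rewrite mulrAC -[_ / vol k]mulrC.
(* Where the flux vanishes, [alpha] keeps its old value, of unknown sign, but its term is zero. *)
have alpha0 f : st_flux s k f != 0 -> 0 <= alpha f.
  rewrite /alpha /=; case: ltgtP => // _ _; case: nbr => [k'|] //;
  by rewrite le_min ?ap0 ?am0.
apply/andP; split.
(* Lower bound: with the fluxes reversed, outflow faces become inflow faces. The neighbour's ratio
   enters [alpha] through a minimum and can only lower it. *)
- have : - (tau * \sum_f alpha f * - st_flux s k f)
      <= - (vol k * (c_min - st_avg s k)).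
    apply: limited_inflow_le => // f; rewrite ?oppr_lt0 ?oppr_gt0 => Hf.
      rewrite -limiter_ratioN opprK -PmE /alpha /= ltNge (ltW Hf) /= Hf.
      by case: nbr => // k'; rewrite ge_min lexx.
    by rewrite alpha0// lt_eqF.
  under eq_bigr do rewrite mulrN.
  rewrite sumrN mulrN opprK -mulrN opprB -ler_pdivrMl// /c_min; lra.
- have : - (tau * \sum_f alpha f * st_flux s k f) <= vol k * (c_max - st_avg s k).
    apply: limited_inflow_le => // f Hf; last by rewrite alpha0// gt_eqF.
    by rewrite /alpha /= Hf; case: nbr => // k'; rewrite ge_min lexx.
  rewrite -ler_pdivrMl// mulrN /c_max; lra.
Qed.

Lemma limiter_output_bounds (M : cube_mesh R) (tau eps1 eps2 : R)
    (cbar : 'I_(nelt M) -> R) (H : 'I_(nelt M) -> face -> R)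
    (cpost : 'I_(nelt M) -> R) :
  (forall k : 'I_(nelt M), 0 < vol k) -> 0 <= tau ->
  (forall k, -1 <= cbar k <= 1) ->
  limiter_output tau eps1 eps2 cbar H cpost ->
  forall k, -1 <= cpost k <= 1.
Proof.
move=> vol_gt0 tau0 cb [m [_ _ _ ->]]; rewrite /limiter_iter.
by elim: m => //= m IH; apply: limiter_step_bounds.
Qed.

End Zalesak.

(** * Slope limiter: from averages to pointwise bounds *)

Section SlopeLimiter.
Context {R : realType} (M : cube_mesh R) (k : 'I_(nelt M)).

Lemma slope_fun0 (g : 'rV[R]_3 -> R) x : slope_fun k g 0 x = cell_avg k g.
Proof. by rewrite /slope_fun mul0r addr0. Qed.

(** The average being in range makes 0 an admissible factor, and the vertex constraints are closed
    linear inequalities in the factor, so they pass to the supremum. *)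
Lemma slope_factor_bounds (g : 'rV[R]_3 -> R) s :
  -1 <= cell_avg k g <= 1 ->
  -1 <= slope_fun k g (slope_factor k g) (vertex k s) <= 1.
Proof.
move=> /andP[gm gM].
rewrite /slope_factor; set A := (X in sup X).
have A0 : A 0.
  by split=> [|s']; rewrite ?lexx ?ler01// slope_fun0 /c_min /c_max gm gM.
have ubA : has_ubound A by exists 1 => b [/andP[]].
have supA0 : 0 <= sup A by exact: ub_le_sup.
(* For [d <= 0] the claim follows from [0 <= sup A]; for [d > 0], [q / d] is an upper bound of
   [A]. *)
have closedA (d q : R) : 0 <= q -> (forall b, A b -> b * d <= q) ->
    sup A * d <= q.
  move=> q0 Ad; have [d0|d0] := leP d 0.
    by apply: le_trans q0; rewrite mulr_ge0_le0.
  rewrite -ler_pdivlMr//; apply: ge_sup; first by exists 0.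
  by move=> b /Ad; rewrite -ler_pdivlMr.
rewrite /slope_fun; set d := dot _ _.
have dM : sup A * d <= 1 - cell_avg k g.
  apply: closedA => [|b [_ /(_ s)]]; first by rewrite subr_ge0.
  by rewrite /slope_fun /c_max => /andP[_]; rewrite -/d; lra.
have dm : sup A * - d <= 1 + cell_avg k g.
  apply: closedA => [|b [_ /(_ s)]]; first by rewrite -lerBlDl sub0r.
  by rewrite /slope_fun /c_min => /andP[+ _]; rewrite -/d; lra.
by move: dM dm; rewrite mulrN; lra.
Qed.

Lemma dot_le_vertex (u w x : 'rV[R]_3) : elt k x ->
  exists s, dot u (x - w) <= dot u (vertex k s - w).
Proof.
(* The maximizing vertex takes the upper end exactly in the coordinates where [u] is nonnegative. *)
move=> kx; exists [ffun a => 0 <= u 0 a]; rewrite /dot ler_sum// => a _.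
have /andP[xm xM] := kx a.
rewrite !mxE ffunE; have [u0|u0] := leP 0 (u 0 a).
  by rewrite ler_wpM2l// mul1r lerB.
by rewrite mul0r addr0 ler_wnM2l ?(ltW u0)// lerB.
Qed.

Lemma slope_fun_bounds (g : 'rV[R]_3 -> R) b x : elt k x ->
  (forall s, -1 <= slope_fun k g b (vertex k s) <= 1) ->
  -1 <= slope_fun k g b x <= 1.
Proof.
have dotZ (c : R) (u w : 'rV[R]_3) : dot (c *: u) w = c * dot u w.
  by rewrite /dot mulr_sumr; apply: eq_bigr => a _; rewrite mxE mulrA.
move=> kx gb; set G := grad g (barycenter k).
(* The vertex [s] bounds the value at [x] from above; [t], obtained for the opposite slope, from
   below. *)
have [s] := dot_le_vertex (b *: G) (barycenter k) kx.
have [t] := dot_le_vertex ((- b) *: G) (barycenter k) kx.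
have := gb s; have := gb t; rewrite /slope_fun -/G !dotZ; lra.
Qed.

Lemma slope_limited_bounds (r : nat) (c c' : dfun M) x :
  slope_limited r c c' -> -1 <= cell_avg k (c k) <= 1 -> elt k x ->
  -1 <= c' k x <= 1.
Proof.
move=> /(_ k)[untr tr] avgb kx.
have [T|nT] := pselect (troubled k (c k)); last first.
  rewrite untr//; have [//|nb] := boolP (-1 <= c k x <= 1).
  by case: nT; exists x.
have [g lin ->] := tr T; apply: slope_fun_bounds => // s.
apply: slope_factor_bounds; move: lin; rewrite /linearized.
by case: ifP => _; [case=> _ ->|move=> ->].
Qed.

End SlopeLimiter.

(** * Integrals and cell averages on cubes *)

Section CubeIntegrals.
Context {R : realType}.

Local Notation mu3 :=
  (@lebesgue_measure R \x @lebesgue_measure R \x @lebesgue_measure R)%E.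

Lemma preimage_open_cube (x0 : 'rV[R]_3) (l : R) : pt3 @^-1` open_cube x0 l =
  (`]x0 0 0, (x0 0 0 + l)[ `*` `]x0 0 1, (x0 0 1 + l)[)
   `*` `]x0 0 2, (x0 0 2 + l)[ :> set (_ * _).
Proof.
have ord3P (P : 'I_3 -> Prop) : P 0 -> P 1 -> P 2 -> forall a, P a.
  move=> P0 P1 P2 a; have := ltn_ord a.
  case Ea: (a : nat) => [|[|[|//]]] _.
  - by rewrite (_ : a = 0)//; apply: ord_inj; rewrite Ea.
  - by rewrite (_ : a = 1)//; apply: ord_inj; rewrite Ea.
  - by rewrite (_ : a = 2)//; apply: ord_inj; rewrite Ea.
apply/seteqP; split=> -[[p q] z] /=.
  move=> H; have := H 0; have := H 1; have := H 2.
  by rewrite !mxE !(tnth_nth 0) /= !in_itv.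
rewrite !in_itv /= => -[[Hp Hq] Hz].
by apply: ord3P; rewrite mxE (tnth_nth 0).
Qed.

Lemma measurable_open_cube (x0 : 'rV[R]_3) (l : R) :
  measurable (pt3 @^-1` open_cube x0 l).
Proof.
by rewrite preimage_open_cube; do 2 apply: measurableX => //.
Qed.

Lemma mu3_open_cube (x0 : 'rV[R]_3) (l : R) : 0 < l ->
  mu3 (pt3 @^-1` open_cube x0 l) = (l ^+ 3)%:E.
Proof.
move=> l0; rewrite preimage_open_cube.
rewrite product_measure1E//; last by apply: measurableX.
rewrite [X in (X * _)%E]product_measure1E//.
rewrite /= !lebesgue_measure_itv /= !lte_fin !ltrDl l0.
rewrite -!EFinB -!EFinM; congr EFin; ring.
Qed.

Lemma measurable_pt3 a : measurable_fun setT (fun p => @pt3 R p 0 a).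
Proof.
under eq_fun do rewrite mxE (tnth_nth 0).
case: a => -[|[|[|//]]] /= _.
- exact: measurableT_comp measurable_fst measurable_fst.
- exact: measurableT_comp measurable_snd measurable_fst.
- exact: measurable_snd.
Qed.

Lemma Qpoly_integrable (x0 : 'rV[R]_3) (l : R) r f : 0 < l -> Qpoly r f ->
  mu3.-integrable (pt3 @^-1` open_cube x0 l) (EFin \o (f \o pt3)).
Proof.
move=> l0 [a fE]; apply: measurable_bounded_integrable.
- exact: measurable_open_cube.
- by rewrite [ltLHS](mu3_open_cube x0 l0) ltry.
- apply: measurable_funTS; rewrite [f \o _](_ : _ = fun p =>
    \sum_m a m * \prod_(i < 3) pt3 p 0 i ^+ m i); last first.
    by apply/funext => p /=; rewrite fE.
  apply: measurable_sum => m; apply: measurable_realfun.measurable_funM; first exact: measurable_cst.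
  by apply: measurable_prod => i _; apply: measurable_realfun.measurable_funX; exact: measurable_pt3.
(* [B i] bounds the i-th coordinate in absolute value on the cube, hence every monomial. *)
- pose B i := `|x0 0 i| + l.
  exists (\sum_m `|a m| * \prod_(i < 3) B i ^+ m i); split.
    by rewrite num_real.
  move=> K /ltW BK p /= px; apply: le_trans BK; rewrite /= fE.
  apply: le_trans (ler_norm_sum _ _ _) _; apply: ler_sum => m _.
  rewrite normrM ler_wpM2l// normr_prod; apply: ler_prod => i _.
  rewrite normr_ge0 normrX lerXn2r ?nnegrE ?addr_ge0 ?(ltW l0)//=.
  have /andP[xm xM] := px i; rewrite /B ler_norml.
  have := ler_norm (x0 0 i); have := ler_norm (- x0 0 i); rewrite normrN; lra.
Qed.

Context (M : cube_mesh R).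
Implicit Types (k : 'I_(nelt M)).

Lemma volE k : vol k = side M ^+ 3.
Proof.
by rewrite /vol /vol3 [X in fine X](mu3_open_cube (corner k) (side_gt0 M)).
Qed.

Lemma vol_gt0 k : 0 < vol k.
Proof. by rewrite volE exprn_gt0 ?side_gt0. Qed.

Lemma cell_avg_bounds k (F : 'rV[R]_3 -> R) :
  (forall x, elt_int k x -> -1 <= F x <= 1) -> -1 <= cell_avg k F <= 1.
Proof.
move=> F1; rewrite -ler_norml /cell_avg normrM normfV.
rewrite (gtr0_norm (vol_gt0 k)) ler_pdivrMl ?vol_gt0// mulr1 -[vol k]mul1r.
apply: norm_Rintegral_le => //.
- exact: measurable_open_cube.
- by rewrite [ltLHS](mu3_open_cube (corner k) (side_gt0 M)) ltry.
- by move=> p /F1; rewrite ler_norml.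
Qed.

(** Additivity of the integral asks for integrable summands, which the polynomial form of [f]
    provides. *)
Lemma cell_avg_shift r k (f : 'rV[R]_3 -> R) (a : R) : Qpoly r f ->
  cell_avg k (fun x => f x + a) = cell_avg k f + a.
Proof.
move=> Qf; rewrite /cell_avg /int_elt /int3.
have fin : (mu3 (pt3 @^-1` elt_int k) < +oo)%E.
  by rewrite [ltLHS](mu3_open_cube (corner k) (side_gt0 M)) ltry.
rewrite (@RintegralD _ _ _ _ _ (f \o pt3) (cst a)).
- rewrite Rintegral_cst; last exact: measurable_open_cube.
  by rewrite mulrDr mulrCA mulVf ?mulr1// gt_eqF ?vol_gt0.
- exact: measurable_open_cube.
- exact: Qpoly_integrable (side_gt0 M) Qf.
- apply: measurable_bounded_integrable => //.
  + exact: measurable_open_cube.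
  + by exists `|a|; split; [exact: num_real|move=> K /ltW aK p _; exact: aK].
Qed.

Lemma elt_int_elt k x : elt_int k x -> elt k x.
Proof. by move=> kx a; have /andP[/ltW -> /ltW ->] := kx a. Qed.

Lemma elt_int_Omega k : elt_int k `<=` Omega M.
Proof.
move=> x kx.
have near_itv (a : 'I_3) : nbhs x [set y : 'rV[R]_3 |
    y 0 a \in `]corner k 0 a, (corner k 0 a + side M)[].
  apply: (@coord_continuous R 1 3 0 a x _ (near_in_itvoo _)).
  by rewrite in_itv; exact: kx.
(* Finitely many coordinate neighbourhoods intersect in a neighbourhood, as the interior in [Omega]
   demands. *)
have := @filter_forall _ _ _ _ (nbhs_filter x) near_itv.
apply: filterS => y ky.
exists k => //; apply: elt_int_elt => a.
by have := ky a; rewrite /= in_itv.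
Qed.

Lemma Qpoly_cst r (a : R) : Qpoly r (fun=> a).
Proof.
exists (fun m => if m == [ffun=> ord0] then a else 0) => x.
rewrite (bigD1 [ffun=> ord0])//= eqxx !big1 ?mulr1 ?addr0//.
  by move=> m /negPf ->; rewrite mul0r.
by move=> i _; rewrite ffunE expr0.
Qed.

(** The indicator of one element lies in the discontinuous space [Xh], so it is an allowed test
    function. *)
Lemma L2_projection_avg r (c0 : dfun M) (g : 'rV[R]_3 -> R) k :
  (forall chi, Xh r chi ->
    int_Omega (fun l x => c0 l x * chi l x)
    = int_Omega (M := M) (fun l x => g x * chi l x)) ->
  cell_avg k (c0 k) = cell_avg k g.
Proof.
move=> /(_ (fun l _ => (l == k)%:R)).
have only (F : dfun M) :
    int_Omega (fun l x => F l x * (l == k)%:R) = int_elt k (F k).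
  rewrite /int_Omega (bigD1 k)//= big1 ?addr0.
    by congr int_elt; apply/funext => x; rewrite eqxx mulr1.
  move=> l /negPf ->; rewrite /int_elt /int3.
  by under eq_Rintegral do rewrite mulr0; rewrite /Rintegral integral0.
rewrite (only c0) (only (fun=> g)) /cell_avg => -> // l; exact: Qpoly_cst.
Qed.

End CubeIntegrals.

Unset Implicit Arguments.

(** * Induction over time steps, for the trace from every element containing the point *)

Theorem theorem1 (R : realType) (M : cube_mesh R)
    (bc : 'I_(nelt M) -> face -> bkind) (r : nat) (hr : (1 <= r)%N)
    (ph : physical_constants R) (sg : penalties R) (dat : problem_data R)
    (T : R) (hT : 0 < T) (NT : nat) (hNT : (0 < NT)%N)
    (eps1 eps2 : R) (heps1 : 0 < eps1) (heps2 : 0 < eps2)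
    (hc_meas : measurable_fun (pt3 @^-1` Omega M) (c_init dat \o pt3))
    (hc_init : forall x, Omega M x -> -1 <= c_init dat x <= 1)
    (S : dg_sequences M)
    (hS : dg_scheme bc r ph sg dat T NT eps1 eps2 S) :
  forall n : nat, (n <= NT)%N ->
  forall x : 'rV[R]_3, Omega M x ->
  forall k : 'I_(nelt M), elt k x -> -1 <= c_h S n k x <= 1.
Proof.
have tau0 : 0 <= T / NT%:R by rewrite divr_ge0 ?(ltW hT).
suff bounds n : (n <= NT)%N ->
    forall k x, elt k x -> -1 <= c_h S n k x <= 1.
  by move=> n nNT x _ k; exact: bounds.
elim: n => [_|n IH nNT] k x kx.
  have [c0 [c0X c0P] c0S] := init_c hS.
  apply: (slope_limited_bounds c0S) => //.
  (* The projection itself may overshoot, but its averages are those of the initial datum. *)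
  rewrite (L2_projection_avg k c0P); apply: cell_avg_bounds => y ky.
  by apply: hc_init; exact: elt_int_Omega ky.
have [c1 [cpost [out c1E] c1S]] := step2 hS nNT.
have [cX _] := step1_space hS nNT.
apply: (slope_limited_bounds c1S) => //.
have -> : cell_avg k (c1 k) = cpost k.
  rewrite (_ : c1 k = fun y =>
    c_pre S n.+1 k y + (cpost k - cell_avg k (c_pre S n.+1 k))).
    by rewrite (cell_avg_shift _ _ (cX k)) addrC subrK.
  by apply/funext => y; rewrite c1E addrAC -addrA.
(* The iteration starts from the averages of the previous [c_h], bounded by induction; [c_pre]
   enters only through the fluxes. *)
apply: (limiter_output_bounds (@vol_gt0 R M) tau0 _ out) => l.
by apply: cell_avg_bounds => y /elt_int_elt; exact: IH (ltnW nNT) l y.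
Qed.
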